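(* Let $n \in \mathbb{N}$ and let $B$ be a maximal lattice-free polytope in $\mathbb{R}^n$. Let $f_1, f_2 \in \operatorname{int}(B)$. Then $B$ has the unique-lifting property with respect to $f_1$ if and only if $B$ has the unique-lifting property with respect to $f_2$.
   Context: A set $B\subseteq\mathbb{R}^n$ is lattice-free if it is $n$-dimensional, closed, convex and $\operatorname{int}(B)\cap\mathbb{Z}^n=\emptyset$; it is maximal lattice-free if it is inclusion-maximal among lattice-free sets. For $f\in\mathbb{R}^n\setminus\mathbb{Z}^n$, a cut-generating pair for $f$ is a pair of nonnegative functions $\psi,\pi:\mathbb{R}^n\to\mathbb{R}$ such that for all integers $k,\ell\ge 0$, not both zero, and all matrices $R\in\mathbb{R}^{n\times k}$ with columns $r_1,\dots,r_k$ and $P\in\mathbb{R}^{n\times \ell}$ with columns $p_1,\dots,p_\ell$, the inequality $\sum_{i=1}^k\psi(r_i)s_i+\sum_{j=1}^\ell\pi(p_j)y_j\ge 1$ holds for every $(s,y)\in\mathbb{R}_+^k\times\mathbb{Z}_+^\ell$ with $f+Rs+Py\in\mathbb{Z}^n$. In this case $\pi$ is called a lifting of $\psi$. A lifting $\pi'$ of $\psi$ dominates a lifting $\pi''$ if $\pi'(r)\le\pi''(r)$ for all $r\in\mathbb{R}^n$; a minimal lifting is a lifting not dominated by another, distinct lifting. For a lattice-free set $B$ and $f\in\operatorname{int}(B)$, the gauge function of $B-f$ is $\phi_{B-f}(r)=\inf\{\rho>0: r/\rho\in B-f\}$. A maximal lattice-free set $B$ has the unique-lifting property with respect to $f\in\operatorname{int}(B)$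 if $\phi_{B-f}$ has exactly one minimal lifting. Known characterization from earlier literature, used by the paper as a working description: for a maximal lattice-free polytope $B$ and $f\in\operatorname{int}(B)$, $B$ has the unique-lifting property with respect to $f$ if and only if $R(B,f)+\mathbb{Z}^n=\mathbb{R}^n$, where $R(B,f)=\bigcup_{F}\bigcup_{z\in F\cap\mathbb{Z}^n}\bigl[\operatorname{conv}(\{f\}\cup F)\cap(z+f-\operatorname{conv}(\{f\}\cup F))\bigr]$, with $F$ ranging over all faces of $B$ other than $\emptyset$ and $B$. *)

(* Defs.v *)
From HB Require Import structures.
From mathcomp Require Import all_boot all_order all_algebra.
From mathcomp Require Import all_classical all_reals all_analysis.

Set Implicit Arguments.
Unset Strict Implicit.
Unset Printing Implicit Defensive.

Import Order.TTheory GRing.Theory Num.Theory.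
Import numFieldNormedType.Exports.

Local Open Scope classical_set_scope.
Local Open Scope ring_scope.

Definition lattice (R : realType) (n : nat) : set 'cV[R]_n :=
  [set x | forall i, x i 0 \is a Num.int].

(* The affine hull of B is R^n: B contains the n + 1 affinely independent
   points x and x + v_1, ..., x + v_n, where the v_i are the columns of V. *)
Definition full_dimensional (R : realType) (n : nat) (B : set 'cV[R]_n) : Prop :=
  exists (x : 'cV[R]_n) (V : 'M[R]_n),
    [/\ B x, V \in unitmx & forall i, B (x + col i V)].

Definition lattice_free (R : realType) (n : nat) (B : set 'cV[R]_n) : Prop :=
  [/\ full_dimensional B, closed B, convex_set B
    & interior B `&` @lattice R n = set0].

Definition maximal_lattice_free (R : realType) (n : nat) (B : set 'cV[R]_n)
    : Prop :=
  lattice_free B /\ forall C, lattice_free C -> B `<=` C -> C = B.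

Definition convex_hull (R : realType) (n : nat) (S : set 'cV[R]_n)
    : set 'cV[R]_n :=
  smallest (@convex_set R 'cV[R]_n) S.

Definition polytope (R : realType) (n : nat) (B : set 'cV[R]_n) : Prop :=
  exists2 S : set 'cV[R]_n, finite_set S & B = convex_hull S.

(* The continuous variables s and the integer variables y are both real column
   vectors, y being restricted to have natural number entries. *)
Definition cut_generating_pair (R : realType) (n : nat) (f : 'cV[R]_n)
    (psi pi : 'cV[R]_n -> R) : Prop :=
  [/\ forall r, 0 <= psi r,
      forall r, 0 <= pi r
    & forall (k l : nat) (M : 'M[R]_(n, k)) (P : 'M[R]_(n, l)),
        ~ (k = 0%N /\ l = 0%N) ->
        forall (s : 'cV[R]_k) (y : 'cV[R]_l),
          (forall i, 0 <= s i 0) ->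
          (forall j, y j 0 \is a Num.nat) ->
          lattice (f + M *m s + P *m y) ->
          1 <= \sum_(i < k) psi (col i M) * s i 0
               + \sum_(j < l) pi (col j P) * y j 0].

Definition lifting (R : realType) (n : nat) (f : 'cV[R]_n)
    (psi pi : 'cV[R]_n -> R) : Prop :=
  cut_generating_pair f psi pi.

Definition dominates (R : realType) (n : nat) (pi1 pi2 : 'cV[R]_n -> R)
    : Prop :=
  forall r, pi1 r <= pi2 r.

Definition minimal_lifting (R : realType) (n : nat) (f : 'cV[R]_n)
    (psi pi : 'cV[R]_n -> R) : Prop :=
  lifting f psi pi /\
  ~ exists pi', [/\ lifting f psi pi', pi' <> pi & dominates pi' pi].

Definition gauge (R : realType) (n : nat) (C : set 'cV[R]_n) (r : 'cV[R]_n)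
    : R :=
  inf [set rho : R | 0 < rho /\ C (rho^-1 *: r)].

(* Meant for f in the interior of a maximal lattice-free set B, in which case
   f is not in the lattice. *)
Definition unique_lifting (R : realType) (n : nat) (B : set 'cV[R]_n)
    (f : 'cV[R]_n) : Prop :=
  exists! pi, minimal_lifting f (gauge [set x - f | x in B]) pi.

(* Main.v *)
Require Import Defs.
From HB Require Import structures.
From mathcomp Require Import all_boot all_order all_algebra.
From mathcomp Require Import all_classical all_reals all_analysis.
From mathcomp Require Import ring lra.

Set Implicit Arguments.
Unset Strict Implicit.
Unset Printing Implicit Defensive.

Import Order.TTheory GRing.Theory Num.Theory.
Import numFieldNormedType.Exports.

Local Open Scope classical_set_scope.
Local Open Scope ring_scope.

(** Write phi for the gauge of B - f and pi* for its infimum over lattice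
    translates, pi*(p) = inf over integral z of phi(p + z). The proof has two
    independent halves.

    Unique lifting is a covering property. Every lifting pi of phi satisfies
    pi(p) >= 1 - pi*(- f - p), and pi* is itself a lifting, because it is
    subadditive and at least 1 on the shifted lattice. So if
    pi*(p) + pi*(- f - p) <= 1 for all p, which is the predicate [covering],
    then pi* lies below every lifting and is the only minimal one
    ([covering_unique]). Conversely, suppose that the sum exceeds 1 at some p;
    by continuity p may be moved into general position. With q = - f - p, one
    can then assign the cost c to p and 1 - c to q, for two different values
    of c ([cost_interval]), and extend each assignment to a lifting: the
    infimal convolution of phi with the monoid generated by the lattice (at no
    cost), by p at cost c and by q at cost 1 - c. Below each lifting there is
    a minimal one, by Zorn. If both minimal liftings were the same pi0, then
    pi0(p) + pi0(q) < 1, although f + p + q = 0 is integral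
    ([unique_covering]).

    Coverings do not depend on f. For a in [0, 1] consider the points x for
    which some integral translate of x lies in (1 - a) f + a B while some
    integral translate of f - x lies in a f + (1 - a) B. Subtracting (1 - a) f
    from x turns this into a condition on a and y in which f does not occur: y
    is in a B and - y is in (1 - a) B, both up to the lattice. These pairs
    (a, y) form a set E in [0, 1] x R^n, and the covering property for f says
    that every line of direction (1, f) meets E. Seen along the direction
    (1, f), the set E is then the graph of a function with values in [0, 1],
    namely of pi* up to a translation, and this function is Lipschitz because
    phi is sublinear. By the intermediate value theorem a line of any
    direction (1, g) crosses such a graph ([covering_crossing]), and when g is
    interior to B the crossing point witnesses the covering property for g
    ([lattice_inf_gauge_transfer]). *)

(** * The integer lattice *)

Section Lattice.
Context {R : realType} {n : nat}.
Implicit Types (x y p : 'cV[R]_n).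

Lemma lattice0 : lattice (0 : 'cV[R]_n).
Proof. by move=> i; rewrite mxE rpred0. Qed.

Lemma latticeD x y : lattice x -> lattice y -> lattice (x + y).
Proof. by move=> Lx Ly i; rewrite mxE rpredD ?Lx ?Ly. Qed.

Lemma latticeN x : lattice x -> lattice (- x).
Proof. by move=> Lx i; rewrite mxE rpredN Lx. Qed.

End Lattice.

(** * Infimal convolutions of sublinear functions *)

Definition nonneg_sublinear {R : realType} {n : nat}
    (phi : 'cV[R]_n -> R) : Prop :=
  [/\ forall x, 0 <= phi x,
      forall x y, phi (x + y) <= phi x + phi y
    & forall a x, 0 <= a -> phi (a *: x) <= a * phi x].

(** A pair (d, k) in S is a displacement d available at the price k. *)
Definition cost_monoid {R : realType} {n : nat} (S : set ('cV[R]_n * R))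
    : Prop :=
  [/\ S (0, 0), forall s t, S s -> S t -> S (s + t)
    & forall s, S s -> 0 <= s.2].

Definition inf_conv {R : realType} {n : nat} (phi : 'cV[R]_n -> R)
    (S : set ('cV[R]_n * R)) (p : 'cV[R]_n) : R :=
  inf [set phi (p - s.1) + s.2 | s in S].

Lemma subadditive_iter {R : realType} {n : nat} (h : 'cV[R]_n -> R) p m :
    h 0 <= 0 -> (forall p q, h (p + q) <= h p + h q) ->
  h (m%:R *: p) <= m%:R * h p.
Proof.
move=> h0 hD; elim: m => [|m IHm]; first by rewrite scale0r mul0r.
rewrite -natr1 scalerDl mulrDl scale1r mul1r.
by apply: le_trans (hD _ _) _; rewrite lerD2r.
Qed.

Section InfConv.
Context {R : realType} {n : nat}.
Variables (phi : 'cV[R]_n -> R) (S : set ('cV[R]_n * R)).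
Hypotheses (phi_sub : nonneg_sublinear phi) (S_mon : cost_monoid S).
Implicit Types p q x : 'cV[R]_n.

Lemma sublinear0 : phi 0 = 0.
Proof.
case: phi_sub => phi0 _ phiZ; apply/eqP; rewrite eq_le phi0 andbT.
by rewrite -(scale0r 0) (le_trans (phiZ 0 0 _)) // mul0r.
Qed.

Lemma inf_conv_le p s : S s -> inf_conv phi S p <= phi (p - s.1) + s.2.
Proof.
move=> Ss; apply: ge_inf; last by exists s.
case: phi_sub S_mon => phi0 _ _ [_ _ S0].
by exists 0 => _ [t St <-]; rewrite addr_ge0 ?S0.
Qed.

Lemma inf_conv_ge p m :
  (forall s, S s -> m <= phi (p - s.1) + s.2) -> m <= inf_conv phi S p.
Proof.
move=> mP; apply: lb_le_inf.
  by case: S_mon => S0 _ _; exists (phi (p - 0) + 0); exists (0, 0).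
by move=> _ [s Ss <-]; exact: mP.
Qed.

Lemma inf_conv_lt p m : inf_conv phi S p < m ->
  exists2 s, S s & phi (p - s.1) + s.2 < m.
Proof.
move=> pm; apply: contrapT => noS; move: pm; apply/negP; rewrite -leNgt.
apply: inf_conv_ge => s Ss; rewrite leNgt; apply/negP => sm.
by apply: noS; exists s.
Qed.

Lemma inf_conv_ge0 p : 0 <= inf_conv phi S p.
Proof.
case: phi_sub S_mon => phi0 _ _ [_ _ S0].
by apply: inf_conv_ge => s Ss; rewrite addr_ge0 ?S0.
Qed.

Lemma inf_conv_le_fun p : inf_conv phi S p <= phi p.
Proof.
case: S_mon => S0 _ _.
by have := inf_conv_le p S0; rewrite subr0 addr0.
Qed.

Lemma inf_conv_le_cost s : S s -> inf_conv phi S s.1 <= s.2.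
Proof.
by move=> Ss; have := inf_conv_le s.1 Ss; rewrite subrr sublinear0 add0r.
Qed.

(** Shifts and costs add up because S is a submonoid, and phi is subadditive. *)
Lemma inf_convD p q :
  inf_conv phi S (p + q) <= inf_conv phi S p + inf_conv phi S q.
Proof.
case: (phi_sub) (S_mon) => _ phiD _ [_ SD _].
rewrite -lerBlDr; apply: inf_conv_ge => s Ss.
rewrite lerBlDr -lerBlDl; apply: inf_conv_ge => t St; rewrite lerBlDl.
apply: le_trans (inf_conv_le _ (SD s t Ss St)) _.
rewrite (_ : p + q - (s + t).1 = (p - s.1) + (q - t.1)); last first.
  by rewrite /= opprD addrACA.
by rewrite [leRHS]addrACA lerD2r phiD.
Qed.

Lemma inf_conv_iter p m : inf_conv phi S (m%:R *: p) <= m%:R * inf_conv phi S p.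
Proof.
apply: subadditive_iter inf_convD.
by rewrite -[leRHS]sublinear0 inf_conv_le_fun.
Qed.

End InfConv.

(** * Liftings *)

Section Liftings.
Context {R : realType} {n : nat}.
Variables (f : 'cV[R]_n) (phi : 'cV[R]_n -> R).
Implicit Types (p q r : 'cV[R]_n) (pi : 'cV[R]_n -> R).

Lemma mulmx_sum_col k (M : 'M[R]_(n, k)) (s : 'cV[R]_k) :
  M *m s = \sum_i s i 0 *: col i M.
Proof.
apply/colP => i; rewrite !mxE summxE; apply: eq_bigr => j _.
by rewrite !mxE mulrC.
Qed.

(** The valid inequality for one continuous and one integer column. *)
Lemma lifting_ge p q pi : lifting f phi pi -> lattice (f + p + q) ->
  1 <= phi p + pi q.
Proof.
case=> _ _ /(_ 1%N 1%N p q) H L.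
have nz : ~ (1%N = 0%N /\ 1%N = 0%N) by case.
have := H nz (const_mx 1) (const_mx 1); rewrite !big_ord1 !mxE !mulr1.
have col1 (x : 'cV[R]_n) : col 0 x = x by apply/colP => i; rewrite mxE.
rewrite !col1; apply=> //; do ?by move=> i; rewrite mxE ?ler01 ?rpred1.
by rewrite !mulmx_sum_col !big_ord1 !mxE !scale1r !col1.
Qed.

(** The valid inequality for two integer columns and no continuous one. *)
Lemma lifting_pair_ge p q pi : lifting f phi pi -> lattice (f + p + q) ->
  1 <= pi p + pi q.
Proof.
case=> _ _ /(_ 0%N 2%N 0 (row_mx p q)) H L.
have nz : ~ (0%N = 0%N /\ 2%N = 0%N) by case.
have := H nz 0 (const_mx 1); rewrite big_ord0 add0r.
have col0 : col ord0 (row_mx p q) = p.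
  by apply/colP => i; rewrite !mxE; case: splitP => // j _; rewrite ord1.
have col1 : col (lift ord0 ord0) (row_mx p q) = q.
  by apply/colP => i; rewrite !mxE; case: splitP => [[[]]|j _] //; rewrite ord1.
rewrite !big_ord_recl !big_ord0 addr0 !mxE !mulr1 col0 col1; apply=> //.
- by case.
- by move=> i; rewrite mxE rpred1.
rewrite mul0mx addr0 mulmx_sum_col !big_ord_recl big_ord0 addr0 !mxE !scale1r.
by rewrite col0 col1 addrA.
Qed.

Hypothesis phi_sub : nonneg_sublinear phi.

(** All columns of an inequality can be merged into one by subadditivity, so
    that only the values on the shifted lattice matter. *)
Lemma subadditive_lifting pi :
    (forall p, 0 <= pi p) -> (forall p q, pi (p + q) <= pi p + pi q) ->
    (forall p, pi p <= phi p) -> (forall z, lattice z -> 1 <= pi (z - f)) ->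
  lifting f phi pi.
Proof.
move=> pi0 piD pi_phi piL; case: (phi_sub) => phi0 _ phiZ; split=> //.
move=> k l M P _ s y s0 yN L.
have pi_0 : pi 0 <= 0 by rewrite (le_trans (pi_phi 0)) // sublinear0.
have merge : pi (M *m s + P *m y)
    <= \sum_(i < k) phi (col i M) * s i 0 + \sum_(j < l) pi (col j P) * y j 0.
  apply: le_trans (piD _ _) _; apply: lerD.
    rewrite mulmx_sum_col; elim/big_ind2: _ => // [p a q b pa qb|i _].
      by rewrite (le_trans (piD _ _)) // lerD.
    by rewrite (le_trans (pi_phi _)) // mulrC phiZ.
  rewrite mulmx_sum_col; elim/big_ind2: _ => // [p a q b pa qb|i _].
    by rewrite (le_trans (piD _ _)) // lerD.
  by have /natrP[m ->] := yN i; rewrite mulrC subadditive_iter.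
apply: le_trans merge.
rewrite (_ : M *m s + P *m y = f + M *m s + P *m y - f) ?piL //.
by apply/colP => i; rewrite !mxE; ring.
Qed.

Lemma inf_conv_lifting (S : set ('cV[R]_n * R)) : cost_monoid S ->
    (forall z s, lattice z -> S s -> 1 <= phi (z - f - s.1) + s.2) ->
  lifting f phi (inf_conv phi S).
Proof.
move=> S_mon S1; apply: subadditive_lifting.
- exact: inf_conv_ge0.
- exact: inf_convD.
- exact: inf_conv_le_fun.
- by move=> z Lz; apply: inf_conv_ge => // s Ss; exact: S1.
Qed.

End Liftings.

(** * Minimal liftings *)

Section Minimal.
Context {R : realType} {n : nat}.
Variables (f : 'cV[R]_n) (phi : 'cV[R]_n -> R).
Implicit Types (p q : 'cV[R]_n) (pi : 'cV[R]_n -> R).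

(** A valid inequality involves only finitely many values of pi, so it survives
    passing to the infimum of a chain. *)
Lemma chain_inf_lifting (A : set ('cV[R]_n -> R)) :
    A !=set0 -> (forall pi, A pi -> lifting f phi pi) ->
    (forall pi pi', A pi -> A pi' -> dominates pi pi' \/ dominates pi' pi) ->
  lifting f phi (fun p => inf [set pi p | pi in A]).
Proof.
move=> [pi0 Api0] Alift Atot.
have Alb p : has_lbound [set pi p | pi in A].
  by exists 0 => _ [pi Api <-]; have [_ + _] := Alift _ Api; exact.
have Ainf p : has_inf [set pi p | pi in A].
  by split; [exists (pi0 p); exists pi0|exact: Alb].
(* A chain reaches near-infimum values at finitely many points at once. *)
have near_inf e (s : seq 'cV[R]_n) : 0 < e -> exists2 pi, A pi &
    forall p, p \in s -> pi p <= inf [set pi p | pi in A] + e.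
  move=> e0; elim: s => [|p s [pi Api pis]]; first by exists pi0.
  have [_ [pi' Api' <-] pi'p] := inf_adherent e0 (Ainf p).
  have [dom|dom] := Atot _ _ Api Api'.
    exists pi => // q; rewrite inE => /orP[/eqP ->|/pis//].
    exact: le_trans (dom p) (ltW pi'p).
  exists pi' => // q; rewrite inE => /orP[/eqP ->|/pis]; first exact: ltW.
  exact: le_trans (dom q).
split.
- by have [] := Alift _ Api0.
- move=> p; apply: lb_le_inf; first by exists (pi0 p); exists pi0.
  by move=> _ [pi Api <-]; have [_ + _] := Alift _ Api; exact.
move=> k l M P kl s y s0 yN L; apply/ler_addgt0Pr => e e0.
have y0 j : 0 <= y j 0 by have /natrP[m ->] := yN j.
have Y0 : 0 <= \sum_j y j 0 by apply: sumr_ge0.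
(* Errors of size e' at the columns add up, with weights y, to at most e. *)
set e' := e / (\sum_j y j 0 + 1).
have e'0 : 0 < e' by rewrite divr_gt0 // ltr_wpDl.
have [pi Api pis] := near_inf e' [seq col j P | j <- enum 'I_l] e'0.
have [_ _ /(_ k l M P kl s y s0 yN L) H] := Alift _ Api.
apply: le_trans H _; rewrite -addrA lerD2l.
have : \sum_(j < l) pi (col j P) * y j 0 <=
    \sum_(j < l) (inf [set pi (col j P) | pi in A] * y j 0 + e' * y j 0).
  apply: ler_sum => j _; rewrite -mulrDl ler_wpM2r // pis //.
  by apply/mapP; exists j; rewrite ?mem_enum.
move=> /le_trans; apply; rewrite big_split lerD2l /= -mulr_sumr.
by rewrite /e' -mulrA ger_pMr // ler_pdivrMl ?mulr1 ?ltr_wpDl // lerDl.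
Qed.

Lemma minimal_lifting_below pi0 : lifting f phi pi0 ->
  exists2 pi, minimal_lifting f phi pi & dominates pi pi0.
Proof.
move=> lift0; pose T := {g : _ -> R | lifting f phi g /\ dominates g pi0}.
pose t0 : T := exist _ pi0 (conj lift0 (fun p => lexx (pi0 p))).
pose Rel (s t : T) := `[< dominates (sval t) (sval s) >].
have [||||[pi [pi_lift pi_dom]] pi_max] := @Zorn T Rel.
- by move=> t; apply/asboolP => p.
- move=> r s t /asboolP rs /asboolP st; apply/asboolP => p.
  exact: le_trans (st p) (rs p).
- move=> [s Ps] [t Pt] /asboolP /= st /asboolP /= ts; apply: eq_exist.
  by apply/funext => p; apply/eqP; rewrite eq_le st ts.
- move=> A Atot; have [[a Aa]|A0] := pselect (A !=set0); last first.
    by exists t0 => s As; case: A0; exists s.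
  pose A' := [set sval a | a in A].
  have lift : lifting f phi (fun p => inf [set pi p | pi in A']).
    apply: chain_inf_lifting.
    - by exists (sval a); exists a.
    - by move=> _ [b Ab <-]; have [] := svalP b.
    - move=> _ _ [b Ab <-] [c Ac <-].
      by have [/asboolP|/asboolP] := Atot _ _ Ab Ac; [right|left].
  have infA b p : A b -> inf [set pi p | pi in A'] <= sval b p.
    move=> Ab; apply: ge_inf; last by exists (sval b) => //; exists b.
    by exists 0 => _ [_ [c _ <-] <-]; have [[_ + _] _] := svalP c; exact.
  have dom : dominates (fun p => inf [set pi p | pi in A']) pi0.
    by move=> p; apply: le_trans (infA _ _ Aa) _; have [_] := svalP a; exact.
  pose t : T :=
    exist (fun g => lifting f phi g /\ dominates g pi0) _ (conj lift dom).
  by exists t => s As; apply/asboolP => p; exact: infA.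
exists pi => //; split=> // -[pi' [lift' ne dom']]; apply: ne.
have dom0 : dominates pi' pi0 by move=> p; exact: le_trans (dom' p) (pi_dom p).
pose t : T :=
  exist (fun g => lifting f phi g /\ dominates g pi0) _ (conj lift' dom0).
by have /(congr1 sval) := pi_max t (asboolT dom').
Qed.

End Minimal.

(** * Two costs for a pair of complementary points *)

Section Costs.
Context {R : realType}.

(** With A m = pi*(- f - m p) and B m = pi*(- f - m q), these are the
    conditions under which p and q may be given the costs c and 1 - c. *)
Let slack (A B : nat -> R) (c : R) :=
  [/\ 0 <= c <= 1, forall m, 1 <= A m + m%:R * c
    & forall m, 1 <= B m + m%:R * (1 - c)].

(** The constraints for m = 1 confine c to the interval from 1 - A 1 to B 1,
    which is not a point. By symmetry, let A 1 <= B 1. If A 1 < 1/2, then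
    values slightly above 1 - A 1 exceed 1/2, which settles the constraints on
    A for m >= 2, while those on B hold at 1 - A 1 with a margin by
    subadditivity. If 1/2 <= A 1, then values slightly above 1/2 satisfy
    everything with m <> 2, and m = 2 uses the positivity of B 2. *)
Lemma cost_interval (A B : nat -> R) :
    (forall m, 0 <= A m) -> (forall m, 0 <= B m) -> 1 <= A 0%N -> 1 <= B 0%N ->
    (forall m, A 1%N <= A m.+1 + m%:R * B 1%N) ->
    (forall m, B 1%N <= B m.+1 + m%:R * A 1%N) ->
    0 < A 1%N -> 0 < B 1%N -> 0 < A 2%N -> 0 < B 2%N -> 1 < A 1%N + B 1%N ->
  exists c1 c2, [/\ c1 < c2, slack A B c1 & slack A B c2].
Proof.
move=> A0 B0 A01 B01 AB BA A1 B1 A2 B2 AB1.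
wlog leAB : A B A0 B0 A01 B01 AB BA A1 B1 A2 B2 AB1 / A 1%N <= B 1%N.
  move=> wl; have [|/ltW] := leP (A 1%N) (B 1%N); first exact: wl.
  move=> /wl[]//; first by rewrite addrC.
  move=> c1 [c2 [c12 [/andP[c10 c11] B1' A1'] [/andP[c20 c21] B2' A2']]].
  exists (1 - c2), (1 - c1); split; first lra.
  - split=> [|m|m]; rewrite ?subKr//; lra.
  - split=> [|m|m]; rewrite ?subKr//; lra.
(* Any interval to the right of c1 will do: take its two end points. *)
suff [c1 [t [t0 slk]]] : exists c1 t, 0 < t /\
    forall u, 0 <= u <= t -> slack A B (c1 + u).
  exists (c1 + 0), (c1 + t); split; first by rewrite ltrD2l.
    by apply: slk; lra.
  by apply: slk; lra.
have [Ahalf|Ahalf] := ltP (A 1%N) (1/2).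
  (* For m steps, subadditivity leaves the margin g - m u; when m is so large
     that this is negative, m (A 1 - u) >= m (A 1) / 2 already exceeds 1. *)
  pose g := A 1%N + B 1%N - 1.
  exists (1 - A 1%N), (A 1%N / 2 * Num.min 1 g).
  have g0 : 0 < g by rewrite /g; lra.
  have m1 : Num.min 1 g <= 1 by rewrite ge_min lexx.
  have mg : Num.min 1 g <= g by rewrite ge_min lexx orbT.
  have m0 : 0 < Num.min 1 g by rewrite lt_min ltr01.
  split=> [|u /andP[u0 ut]]; first by rewrite mulr_gt0 // divr_gt0.
  have uA : u <= A 1%N / 2 by nra.
  have ug : u <= A 1%N / 2 * g by nra.
  split; first lra.
  - move=> [|[|m]]; [by rewrite mul0r addr0|lra|].
    have := A0 m.+2; have := ler0n R m; rewrite -addn2 natrD; nra.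
  - move=> [|m]; first by rewrite mul0r addr0.
    have := BA m; have := B0 m.+1; rewrite -natr1.
    have := ler0n R m; move: (m%:R) => x x0 Bm BAm.
    have [le|lt] := leP ((x + 1) * u) g; first by rewrite /g in le *; nra.
    have xA : 2 < (x + 1) * A 1%N.
      have : g < (x + 1) * (A 1%N / 2 * g) by nra.
      nra.
    nra.
(* 1/6 makes 1 - c >= 1/3, which is what the constraints with m >= 3 need. *)
exists (1/2), (Num.min (1/6) (Num.min (B 1%N - 1/2) (B 2%N / 2))).
split; first by rewrite !lt_min; apply/and3P; split; lra.
move=> u /andP[u0]; rewrite !le_min => /and3P[u1 u2 u3]; split; first lra.
- move=> [|[|m]]; [by rewrite mul0r addr0|lra|].
  have := A0 m.+2; have := ler0n R m; rewrite -addn2 natrD; nra.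
- move=> [|[|[|m]]]; [by rewrite mul0r addr0|lra|lra|].
  have := B0 m.+3; have := ler0n R m; rewrite -addn3 natrD; nra.
Qed.

End Costs.

(** * Unique liftings and coverings *)

Definition lattice_moves {R : realType} {n : nat} : set ('cV[R]_n * R) :=
  [set s | lattice s.1 /\ s.2 = 0].

Definition lattice_inf {R : realType} {n : nat} (phi : 'cV[R]_n -> R) :=
  inf_conv phi lattice_moves.

(** For a gauge phi of B - f, this says that the lattice translates of the
    lifting region R(B, f) cover R^n: the reverse inequality always holds, and
    equality for integral translates p + z and - f - p + w means that the
    point f + p + z lies in a spindle with lattice vertex z + w. *)
Definition covering {R : realType} {n : nat} (f : 'cV[R]_n)
    (phi : 'cV[R]_n -> R) : Prop :=
  forall p, lattice_inf phi p + lattice_inf phi (- f - p) <= 1.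

Definition two_point_moves {R : realType} {n : nat} (p q : 'cV[R]_n) (c : R)
    : set ('cV[R]_n * R) :=
  [set s | exists z (i j : nat), lattice z /\
     s = (z + i%:R *: p + j%:R *: q, i%:R * c + j%:R * (1 - c))].

(** A point slightly to the right of x lies strictly between two consecutive
    integers, whether x is an integer or not. *)
Lemma near_nonint {R : realType} (x k : R) : 0 < k ->
  \forall t \near 0^'+, (x + k * t \isn't a Num.int).
Proof.
move=> k0; have /andP[fx xf] := floor_itv x.
have gap : 0 < ((Num.floor x + 1)%:~R - x) / k by rewrite divr_gt0 ?subr_gt0.
near=> t.
have t0 : 0 < t by near: t; exact: nbhs_right_gt.
have : t < ((Num.floor x + 1)%:~R - x) / k by near: t; exact: nbhs_right_lt.
rewrite ltr_pdivlMr // => tg; apply/negP => /intrP[m xm].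
have : (Num.floor x)%:~R < m%:~R :> R by rewrite -xm; nra.
have : m%:~R < (Num.floor x + 1)%:~R :> R by rewrite -xm; nra.
by rewrite !ltr_int ltzD1 => /le_lt_trans /[apply]; rewrite ltxx.
Unshelve. all: by end_near. Qed.

Lemma lipschitz_bound_continuous {R : realType} (h : R -> R) (L : R) : 0 <= L ->
  (forall a b, h b <= h a + L * `|b - a|) -> continuous h.
Proof.
move=> L0 hL a; apply/cvgrPdist_le => /= e e0; near=> b.
have lab : L * `|a - b| <= e.
  have : `|a - b| <= e / (L + 1).
    near: b; apply: cvgr_dist_le; first exact: cvg_id.
    by rewrite divr_gt0 // ltr_wpDl.
  by rewrite ler_pdivlMr ?ltr_wpDl //; have := normr_ge0 (a - b); nra.
rewrite ler_norml; have := hL a b; have := hL b a.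
by rewrite (distrC b a); lra.
Unshelve. all: by end_near. Qed.

Section LatticeInf.
Context {R : realType} {n : nat}.
Variables (f : 'cV[R]_n) (phi : 'cV[R]_n -> R).
Hypotheses (phi_sub : nonneg_sublinear phi)
  (phi_lat : forall z, lattice z -> 1 <= phi (z - f)).
Implicit Types (p q r z w : 'cV[R]_n).

Lemma lattice_moves_monoid : cost_monoid (@lattice_moves R n).
Proof.
split=> [|s t [Ls s0] [Lt t0]|s [_ ->]] //.
  by split=> //; exact: lattice0.
by split; [exact: latticeD|rewrite /= s0 t0 addr0].
Qed.
Let LM := lattice_moves_monoid.

Lemma lattice_inf_le p z : lattice z -> lattice_inf phi p <= phi (p + z).
Proof.
move=> Lz; have := @inf_conv_le _ _ phi _ phi_sub LM p (- z, 0).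
by rewrite /= opprK addr0; apply; split=> //; exact: latticeN.
Qed.

Lemma lattice_inf_ge p m :
  (forall z, lattice z -> m <= phi (p + z)) -> m <= lattice_inf phi p.
Proof.
move=> H; apply: (inf_conv_ge LM) => -[z _] [/= Lz ->].
by rewrite addr0 H //; exact: latticeN.
Qed.

Lemma lattice_inf_lt p m : lattice_inf phi p < m ->
  exists2 z, lattice z & phi (p + z) < m.
Proof.
move=> /(inf_conv_lt LM)[[z _] [/= Lz ->]]; rewrite addr0 => H.
by exists (- z) => //; exact: latticeN.
Qed.

Lemma lattice_infD p q :
  lattice_inf phi (p + q) <= lattice_inf phi p + lattice_inf phi q.
Proof. exact: inf_convD. Qed.

Lemma lattice_inf_ge0 p : 0 <= lattice_inf phi p.
Proof. exact: inf_conv_ge0. Qed.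

Lemma lattice_inf_line_continuous p v :
  continuous (fun a : R => lattice_inf phi (p + a *: v)).
Proof.
case: (phi_sub) => phi0 _ phiZ.
apply: (@lipschitz_bound_continuous _ _ (phi v + phi (- v))) => [|a b].
  exact: addr_ge0.
have -> : p + b *: v = p + a *: v + (b - a) *: v.
  by apply/colP => k; rewrite !mxE; ring.
apply: le_trans (lattice_infD _ _) _; rewrite lerD2l.
apply: le_trans (inf_conv_le_fun phi_sub LM _) _.
have [ab|ab] := leP 0 (b - a).
  by rewrite (le_trans (phiZ _ _ ab)) // ger0_norm // mulrC ler_wpM2r // lerDl.
rewrite -[_ *: v]opprK -scalerN -scaleNr ltr0_norm //.
have ab' : 0 <= - (b - a) by rewrite oppr_ge0 ltW.
by rewrite (le_trans (phiZ _ _ ab')) // mulrC ler_wpM2r // lerDr.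
Qed.

Lemma lattice_inf_ge1 z : lattice z -> 1 <= lattice_inf phi (z - f).
Proof.
move=> Lz; apply: lattice_inf_ge => w Lw.
by rewrite addrAC phi_lat //; exact: latticeD.
Qed.

Lemma lattice_inf_lifting : lifting f phi (lattice_inf phi).
Proof.
apply: inf_conv_lifting => // z s Lz [Ls ->].
by rewrite addr0 addrAC phi_lat //; apply: latticeD => //; exact: latticeN.
Qed.

(** Complete the integer column p by a continuous column reaching a lattice
    point; the best choice of that point gives the infimum. *)
Lemma lifting_ge_lattice_inf pi p :
  lifting f phi pi -> 1 <= lattice_inf phi (- f - p) + pi p.
Proof.
move=> pi_lift; rewrite -lerBlDr; apply: lattice_inf_ge => z Lz.
rewrite lerBlDr; apply: lifting_ge pi_lift _.
by rewrite (_ : _ + _ = z) //; apply/colP => i; rewrite !mxE; ring.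
Qed.

Lemma covering_unique : covering f phi ->
  exists! pi, minimal_lifting f phi pi.
Proof.
move=> cov.
have least pi : lifting f phi pi -> dominates (lattice_inf phi) pi.
  by move=> /lifting_ge_lattice_inf + p => /(_ p); have := cov p; lra.
exists (lattice_inf phi); split=> [|pi [pi_lift pi_min]].
  split; first exact: lattice_inf_lifting.
  move=> [pi [/least le ne ge]]; apply: ne; apply/funext => p.
  by apply/eqP; rewrite eq_le ge le.
apply: contrapT => ne; apply: pi_min; exists (lattice_inf phi).
by split; [exact: lattice_inf_lifting|exact: ne|exact: least].
Qed.

(** Intermediate value theorem for a |-> pi*(p + a v) - a on [0, 1]; the
    covering inequality serves to bound pi* by 1, and to pass from p + a v to
    the complementary point. *)
Lemma covering_crossing p v : covering f phi -> exists a,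
  [/\ 0 <= a <= 1, lattice_inf phi (p + a *: v) <= a
    & lattice_inf phi (- f - (p + a *: v)) <= 1 - a].
Proof.
move=> cov; pose h a := lattice_inf phi (p + a *: v) - a.
have hcont : continuous h.
  by move=> a; apply: cvgB; [exact: lattice_inf_line_continuous|exact: cvg_id].
have h0 : 0 <= h 0 by rewrite /h subr0 lattice_inf_ge0.
have h1 : h 1 <= 0.
  by rewrite subr_le0 (le_trans _ (cov (p + 1 *: v))) // lerDl lattice_inf_ge0.
have [||a] := @IVT R h 0 1 0 ler01; first exact: continuous_subspaceT.
  by rewrite ge_min le_max h0 h1 orbT.
rewrite in_itv /= => a01 /eqP; rewrite subr_eq0 => /eqP ha.
exists a; split=> //; first by rewrite ha.
by have := cov (p + a *: v); rewrite ha addrC -lerBrDr.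
Qed.

(** The lifting is the infimal convolution of phi with [two_point_moves]. A move
    using both p and q costs at least c + (1 - c) = 1, so only moves that use
    one of the two points several times constrain c. *)
Lemma two_point_lifting p q c : lattice (f + p + q) -> 0 <= c <= 1 ->
    (forall i, 1 <= lattice_inf phi (- f - i%:R *: p) + i%:R * c) ->
    (forall j, 1 <= lattice_inf phi (- f - j%:R *: q) + j%:R * (1 - c)) ->
  exists pi, [/\ lifting f phi pi, pi p <= c & pi q <= 1 - c].
Proof.
move=> Lpq /andP[c0 c1] Hp Hq; pose S := two_point_moves p q c.
have SM : cost_monoid S.
  split=> [|_ _ [z [i [j [Lz ->]]]] [z' [i' [j' [Lz' ->]]]]|
           s [z [i [j [_ ->]]]]].
  - exists 0, 0%N, 0%N; split; first exact: lattice0.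
    by rewrite !scale0r !mul0r !addr0.
  - exists (z + z'), (i + i')%N, (j + j')%N; split; first exact: latticeD.
    rewrite !natrD; congr (_, _); last by rewrite /=; ring.
    by apply/colP => k; rewrite !mxE; ring.
  - by rewrite /= addr_ge0 // mulr_ge0 // subr_ge0.
exists (inf_conv phi S); split.
- apply: inf_conv_lifting => // z _ Lz [w [i [j [Lw ->]]]] /=.
  have Lzw : lattice (z - w) by apply: latticeD => //; exact: latticeN.
  have phi0 x : 0 <= phi x by case: phi_sub.
  case: i j => [|i] [|j].
  + apply: le_trans (Hp 0%N) _; rewrite !scale0r !mul0r !addr0 subr0.
    rewrite (_ : _ - _ = - f + (z - w)) ?lattice_inf_le //.
    by apply/colP => k; rewrite !mxE; ring.
  + apply: le_trans (Hq j.+1) _; rewrite scale0r mul0r add0r addr0 lerD2r.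
    rewrite (_ : _ - (_ + _) = - f - j.+1%:R *: q + (z - w)) ?lattice_inf_le //.
    by apply/colP => k; rewrite !mxE; ring.
  + apply: le_trans (Hp i.+1) _; rewrite scale0r mul0r !addr0 lerD2r.
    rewrite (_ : _ - (_ + _) = - f - i.+1%:R *: p + (z - w)) ?lattice_inf_le //.
    by apply/colP => k; rewrite !mxE; ring.
  + rewrite -!natr1; have := ler0n R i; have := ler0n R j.
    by have := phi0 (z - f - (w + (i%:R + 1) *: p + (j%:R + 1) *: q)); nra.
- apply: (inf_conv_le_cost phi_sub SM (s := (p, c))).
  exists 0, 1%N, 0%N; split; first exact: lattice0.
  by rewrite scale0r scale1r mul0r mul1r add0r !addr0.
- apply: (inf_conv_le_cost phi_sub SM (s := (q, 1 - c))).
  exists 0, 0%N, 1%N; split; first exact: lattice0.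
  by rewrite scale0r scale1r mul0r mul1r !add0r.
Qed.

Hypothesis phi_pos : forall p, ~ lattice p -> 0 < lattice_inf phi p.

(** The three genericity conditions are what makes the lattice infima at p, q,
    - f - 2 p and - f - 2 q positive, where q = - f - p. For instance, when
    f + 2 p is integral, p and q agree up to the lattice, and both costs must
    be 1/2. *)
Lemma unique_le1_generic p : ~ lattice p -> ~ lattice (- f - p) ->
    ~ lattice (f + 2 *: p) -> (exists! pi, minimal_lifting f phi pi) ->
  lattice_inf phi p + lattice_inf phi (- f - p) <= 1.
Proof.
move=> Np Nq N2 [pi0 [[pi0_lift _] pi0_uniq]]; rewrite leNgt; apply/negP => gap.
set q := - f - p in Nq gap.
have qE : - f - q = p by apply/colP => k; rewrite !mxE; ring.
have Lpq : lattice (f + p + q).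
  rewrite (_ : _ + _ = 0); first exact: lattice0.
  by apply/colP => k; rewrite !mxE; ring.
pose A m := lattice_inf phi (- f - m%:R *: p).
pose B m := lattice_inf phi (- f - m%:R *: q).
have A_1 : A 1%N = lattice_inf phi q by rewrite /A scale1r.
have B_1 : B 1%N = lattice_inf phi p by rewrite /B scale1r qE.
have ge0 x m : 0 <= lattice_inf phi (- f - m%:R *: x) by exact: lattice_inf_ge0.
have ge1 (x : 'cV[R]_n) : 1 <= lattice_inf phi (- f - 0%:R *: x).
  by rewrite scale0r subr0 -[- f]add0r lattice_inf_ge1 //; exact: lattice0.
have step x m : lattice_inf phi (- f - x) <=
    lattice_inf phi (- f - m.+1%:R *: x) + m%:R * lattice_inf phi x.
  apply: le_trans (lerD (lexx _) (inf_conv_iter phi_sub LM x m)).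
  rewrite (_ : - f - x = - f - m.+1%:R *: x + m%:R *: x) ?lattice_infD //.
  by apply/colP => k; rewrite !mxE -natr1; ring.
have AB m : A 1%N <= A m.+1 + m%:R * B 1%N by rewrite A_1 B_1; exact: step.
have BA m : B 1%N <= B m.+1 + m%:R * A 1%N.
  by rewrite A_1 B_1 -{1}qE; exact: step.
have A1 : 0 < A 1%N by rewrite A_1; exact: phi_pos.
have B1 : 0 < B 1%N by rewrite B_1; exact: phi_pos.
have A2 : 0 < A 2%N.
  apply: phi_pos => /latticeN; rewrite (_ : - _ = f + 2 *: p) //.
  by apply/colP => k; rewrite !mxE; ring.
have B2 : 0 < B 2%N.
  apply: phi_pos; rewrite (_ : _ - _ = f + 2 *: p) //.
  by apply/colP => k; rewrite !mxE; ring.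
have AB1 : 1 < A 1%N + B 1%N by rewrite A_1 B_1 addrC.
have [c1 [c2 [c12 [c1I c1p c1q] [c2I c2p c2q]]]] :=
  cost_interval (ge0 p) (ge0 q) (ge1 p) (ge1 q) AB BA A1 B1 A2 B2 AB1.
have [pi1 [pi1_lift pi1p _]] := two_point_lifting Lpq c1I c1p c1q.
have [pi2 [pi2_lift _ pi2q]] := two_point_lifting Lpq c2I c2p c2q.
have [mu1 /pi0_uniq <- /(_ p) /le_trans/(_ pi1p) le1] :=
  minimal_lifting_below pi1_lift.
have [mu2 /pi0_uniq <- /(_ q) /le_trans/(_ pi2q) le2] :=
  minimal_lifting_below pi2_lift.
have := lifting_pair_ge pi0_lift Lpq; apply/negP; rewrite -ltNge.
by rewrite (le_lt_trans (lerD le1 le2)) // addrCA gtrDl subr_lt0.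
Qed.

(** Moving p a little along the all-ones vector keeps the strict inequality, and
    it makes one coordinate, hence each of the three points, non-integral. *)
Lemma unique_covering (i0 : 'I_n) :
  (exists! pi, minimal_lifting f phi pi) -> covering f phi.
Proof.
move=> uniq p; rewrite leNgt; apply/negP => gap.
pose one : 'cV[R]_n := const_mx 1.
have gap0 : 1 < lattice_inf phi (p + 0 *: one)
    + lattice_inf phi (- f - p + 0 *: - one) by rewrite !scale0r !addr0.
have [t [gap_t tp tq tpq]] : exists t, [/\
    1 < lattice_inf phi (p + t *: one) + lattice_inf phi (- f - p + t *: - one),
    p i0 0 + 1 * t \isn't a Num.int, f i0 0 + p i0 0 + 1 * t \isn't a Num.int
    & f i0 0 + 2 * p i0 0 + 2 * t \isn't a Num.int].
  apply: (@filter_ex _ (0 : R)^'+); near=> t; split.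
  - near: t; apply: cvgr_gt gap0; apply: cvg_at_right_filter.
    exact: cvgD (@lattice_inf_line_continuous _ _ 0)
      (@lattice_inf_line_continuous _ _ 0).
  - by near: t; exact: near_nonint.
  - by near: t; exact: near_nonint.
  - by near: t; exact: near_nonint.
have := unique_le1_generic (p := p + t *: one) _ _ _ uniq.
have -> : - f - (p + t *: one) = - f - p + t *: - one.
  by apply/colP => k; rewrite !mxE; ring.
rewrite leNgt gap_t => H; suff : false by [].
apply: H => /(_ i0).
- by rewrite !mxE mulrC; exact/negP.
- rewrite !mxE => H; case/negP: tq; rewrite -rpredN.
  by rewrite (_ : - _ = - f i0 0 - p i0 0 + t * - 1) //; ring.
- rewrite !mxE => H; case/negP: tpq.
  by rewrite (_ : _ + _ = f i0 0 + 2 * (p i0 0 + t * 1)) //; ring.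
Unshelve. all: by end_near. Qed.

End LatticeInf.

(** * The gauge of a convex set *)

Section Gauge.
Context {R : realType} {n : nat}.
Variable B : set 'cV[R]_n.
Implicit Types (f x y z r : 'cV[R]_n).

Definition gauge_at f : 'cV[R]_n -> R := gauge [set x - f | x in B].

Lemma convex_combination : convex_set B -> forall x y a, 0 <= a <= 1 ->
  B x -> B y -> B (a *: x + (1 - a) *: y).
Proof.
move=> Bconv x y a /andP[a0 a1] Bx By.
have a01 : Itv.spec (@Itv.num_sem R) (Itv.Real `[0%Z, 1%Z]) a.
  by rewrite /Itv.spec /Itv.num_sem /= in_itv /= num_real a0 a1.
by have := Bconv x y (Itv.mk a01) (mem_set Bx) (mem_set By) => /set_mem.
Qed.

Lemma interior_box f : interior B f ->
  exists2 e, 0 < e & forall x, (forall i, `|f i 0 - x i 0| < e) -> B x.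
Proof.
rewrite /interior -nbhs_ballE => -[e /= e0 eB]; exists e => // x fx.
by apply: eB; split=> // i j; rewrite ord1; exact: fx.
Qed.

Lemma box_interior f e : 0 < e ->
  (forall x, (forall i, `|f i 0 - x i 0| < e) -> B x) -> interior B f.
Proof.
move=> e0 eB; rewrite /interior -nbhs_ballE; exists e => // x [_ fx].
by apply: eB => i; exact: fx.
Qed.

Lemma gauge_at_le f r t : 0 < t -> B (f + t^-1 *: r) -> gauge_at f r <= t.
Proof.
move=> t0 Bt; apply: ge_inf; first by exists 0 => s [/ltW].
by split=> //; exists (f + t^-1 *: r) => //; rewrite addrC addKr.
Qed.

Hypothesis Bconv : convex_set B.

Section Point.
Variable f : 'cV[R]_n.
Hypothesis fB : interior B f.

Let Bf : B f. Proof. exact: interior_subset fB. Qed.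

Lemma gauge_at_nonempty r :
  [set rho : R | 0 < rho /\ [set x - f | x in B] (rho^-1 *: r)] !=set0.
Proof.
have [e e0 eB] := interior_box fB.
pose M := \sum_i `|r i 0| + 1.
have Mr i : `|r i 0| < M.
  rewrite /M (bigD1 i) //= -addrA ltrDl ltr_wpDl //.
  by apply: sumr_ge0.
have M0 : 0 < M by rewrite /M ltr_wpDl // sumr_ge0.
exists (M / e); split; first exact: divr_gt0.
exists (f + (M / e)^-1 *: r); last by rewrite addrC addKr.
apply: eB => i; rewrite !mxE opprD addNKr normrN normrM normfV.
rewrite (gtr0_norm (divr_gt0 M0 e0)) invf_div mulrAC ltr_pdivrMr //.
by rewrite ltr_pM2l.
Qed.

Lemma gauge_at_ge0 r : 0 <= gauge_at f r.
Proof. by apply: lb_le_inf (gauge_at_nonempty r) _ => t [/ltW]. Qed.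

(** Scaling towards f keeps points in B. *)
Lemma gauge_at_lt r t : gauge_at f r < t -> 0 < t /\ B (f + t^-1 *: r).
Proof.
move=> rt; have t0 : 0 < t by apply: le_lt_trans rt; exact: gauge_at_ge0.
have hasinf : has_inf
    [set rho : R | 0 < rho /\ [set x - f | x in B] (rho^-1 *: r)].
  by split; [exact: gauge_at_nonempty|exists 0 => s [/ltW]].
have rt' : 0 < t - gauge_at f r by rewrite subr_gt0.
have [s [s0 [x Bx xs]]] := inf_adherent rt' hasinf.
rewrite -/(gauge_at f r) addrC subrK => st; split=> //.
have -> : f + t^-1 *: r = (s / t) *: x + (1 - s / t) *: f.
  have -> : x = f + s^-1 *: r by rewrite -xs addrC subrK.
  by apply/colP => i; rewrite !mxE; field; rewrite !gt_eqF.
apply: convex_combination => //.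
by rewrite divr_ge0 ?(ltW s0) ?(ltW t0) //= ler_pdivrMr // mul1r ltW.
Qed.

Lemma gauge_at_sublinear : nonneg_sublinear (gauge_at f).
Proof.
have g0 := gauge_at_ge0; split=> // [x y|a x].
  apply/ler_addgt0Pr => e e0.
  have [|s0 Bs] := @gauge_at_lt x (gauge_at f x + e / 2).
    by rewrite ltrDl divr_gt0.
  have [|t0 Bt] := @gauge_at_lt y (gauge_at f y + e / 2).
    by rewrite ltrDl divr_gt0.
  set s := gauge_at f x + _ in s0 Bs; set t := gauge_at f y + _ in t0 Bt.
  rewrite (_ : _ + e = s + t); last by rewrite /s /t; field.
  apply: gauge_at_le; first exact: addr_gt0.
  have st0 : s + t != 0 by rewrite gt_eqF // addr_gt0.
  have -> : f + (s + t)^-1 *: (x + y) = (s / (s + t)) *: (f + s^-1 *: x)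
      + (1 - s / (s + t)) *: (f + t^-1 *: y).
    by apply/colP => i; rewrite !mxE; field; rewrite !gt_eqF // addr_gt0.
  apply: convex_combination => //.
  have st1 : 0 < s + t by exact: addr_gt0.
  rewrite divr_ge0 ?(ltW s0) ?(ltW st1) //=.
  by rewrite ler_pdivrMr // mul1r lerDl ltW.
rewrite le_eqVlt => /predU1P[<-|a0].
  rewrite scale0r mul0r; apply/ler_addgt0Pr => e e0; rewrite add0r.
  by apply: gauge_at_le => //; rewrite scaler0 addr0.
apply/ler_addgt0Pr => e e0.
have [|t0 Bt] := @gauge_at_lt x (gauge_at f x + e / a).
  by rewrite ltrDl divr_gt0.
rewrite (_ : _ + e = a * (gauge_at f x + e / a)); last by field; rewrite gt_eqF.
apply: gauge_at_le; first exact: mulr_gt0.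
by rewrite scalerA invfM mulrC mulVKf ?gt_eqF.
Qed.

(** A lattice point of gauge less than 1 would be a proper convex combination of
    a point of B and of the interior point f, hence interior to B. *)
Lemma gauge_at_lattice z : interior B `&` @lattice R n = set0 -> lattice z ->
  1 <= gauge_at f (z - f).
Proof.
move=> Bfree Lz; rewrite leNgt; apply/negP => z1.
have [s /andP[zs s1]] : exists s, gauge_at f (z - f) < s < 1.
  by exists ((gauge_at f (z - f) + 1) / 2); lra.
have [s0 Bs] := gauge_at_lt zs.
have [e e0 eB] := interior_box fB.
suff : (interior B `&` @lattice R n) z by rewrite Bfree.
split=> //; apply: (@box_interior z ((1 - s) * e)).
  by rewrite mulr_gt0 // subr_gt0.
move=> x zx; pose y := f + (1 - s)^-1 *: (x - z).
have s1' : 1 - s != 0 by rewrite gt_eqF // subr_gt0.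
have -> : x = s *: (f + s^-1 *: (z - f)) + (1 - s) *: y.
  by apply/colP => i; rewrite !mxE; field; rewrite s1' gt_eqF.
apply: convex_combination => //; first by rewrite !ltW.
apply: eB => i; rewrite !mxE opprD addNKr normrN normrM normfV.
rewrite (gtr0_norm (_ : 0 < 1 - s)) ?subr_gt0 // mulrC ltr_pdivrMr ?subr_gt0 //.
by rewrite distrC mulrC.
Qed.

(** Some coordinate of p keeps a distance d > 0 from the integers, and the gauge
    controls this coordinate because B is bounded. *)
Lemma lattice_inf_gauge_gt0 M p : (forall x i, B x -> `|x i 0| <= M) ->
  ~ lattice p -> 0 < lattice_inf (gauge_at f) p.
Proof.
move=> BM /existsNP[i /negP pi].
have /andP[fl fu] := floor_itv (p i 0).
have fl' : (Num.floor (p i 0))%:~R < p i 0.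
  by rewrite lt_neqAle fl andbT -intrEfloor.
set k := Num.floor _ in fl fl' fu.
pose d := Num.min (p i 0 - k%:~R) ((k + 1)%:~R - p i 0).
have d0 : 0 < d by rewrite lt_min !subr_gt0 fl' fu.
have [dl du] : d <= p i 0 - k%:~R /\ d <= (k + 1)%:~R - p i 0.
  by rewrite !ge_min !lexx orbT.
have M0 : 0 <= M by exact: le_trans (BM _ i Bf).
pose M' := M + `|f i 0| + 1.
have M'0 : 0 < M' by rewrite /M' ltr_wpDl // addr_ge0.
apply: lt_le_trans (divr_gt0 d0 M'0) _; apply: lattice_inf_ge => z Lz.
rewrite leNgt; apply/negP => /gauge_at_lt[t0 /(BM _ i)].
set t := d / M' in t0 *; rewrite !mxE => Mt.
have dp : d <= `|p i 0 + z i 0|.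
  have /intrP[m zm] := Lz i; rewrite zm.
  have [km|km] := lerP (k + 1) (- m).
    have : (k + 1)%:~R <= (- m)%:~R :> R by rewrite ler_int.
    by rewrite rmorphN /= => km'; rewrite ler_normr; apply/orP; right; lra.
  have : (- m)%:~R <= k%:~R :> R by rewrite ler_int -ltzD1.
  by rewrite rmorphN /= => km'; rewrite ler_normr; apply/orP; left; lra.
have : `|t^-1 * (p i 0 + z i 0)| <= M + `|f i 0|.
  rewrite -[t^-1 * _](addKr (f i 0)) (le_trans (ler_normD _ _)) // normrN addrC.
  by rewrite lerD2r.
rewrite normrM normfV (gtr0_norm t0) mulrC ler_pdivrMr //.
have : t * M' = d by rewrite /t divfK // gt_eqF.
by rewrite /M'; lra.
Qed.

End Point.

(** For the infimum replaced by an exact value, r + c (g - f) + z = c (b - f)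
    with b in B gives r + z = c (b - g), so that the same b works for g. An
    error d in the scaling factor costs at most d times the gauge of g - f. *)
Lemma lattice_inf_gauge_transfer f g r c :
    interior B f -> interior B g -> 0 <= c ->
    lattice_inf (gauge_at f) (r + c *: (g - f)) <= c ->
  lattice_inf (gauge_at g) r <= c.
Proof.
move=> fB gB c0 rc; have subg := gauge_at_sublinear gB.
have [_ gD gZ] := subg.
apply/ler_addgt0Pr => e e0; pose K := gauge_at g (g - f) + 1.
have K0 : 0 < K by rewrite ltr_wpDl // gauge_at_ge0.
have [d d0 <-] : exists2 d, 0 < d & d * K = e.
  by exists (e / K); [exact: divr_gt0|rewrite divfK ?gt_eqF].
have rcd : lattice_inf (gauge_at f) (r + c *: (g - f)) < c + d.
  by rewrite (le_lt_trans rc) // ltrDl.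
have [z Lz /(gauge_at_lt fB)[cd0 Bcd]] := lattice_inf_lt rcd.
apply: le_trans (lattice_inf_le subg _ Lz) _.
set y := f + _ in Bcd.
have -> : r + z = (c + d) *: (y - g) + d *: (g - f).
  by apply/colP => k; rewrite !mxE; field; rewrite gt_eqF.
apply: le_trans (gD _ _) _; rewrite mulrDr mulr1 [d * _ + d]addrC addrA lerD //.
  apply: gauge_at_le => //; rewrite scalerA mulVf ?gt_eqF // scale1r.
  by rewrite addrC subrK.
by rewrite gZ // ltW.
Qed.

Lemma covering_gauge_invariant f g : interior B f -> interior B g ->
  covering f (gauge_at f) -> covering g (gauge_at g).
Proof.
move=> fB gB cov p; have subf := gauge_at_sublinear fB.
have [a [/andP[a0 a1] le_a le_1a]] := covering_crossing subf p (g - f) cov.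
rewrite (_ : 1 = a + (1 - a)); last by rewrite addrC subrK.
apply: lerD; first exact: lattice_inf_gauge_transfer le_a.
apply: (lattice_inf_gauge_transfer fB gB); first by rewrite subr_ge0.
have -> : - g - p + (1 - a) *: (g - f) = - f - (p + a *: (g - f)).
  by apply/colP => k; rewrite !mxE; ring.
exact: le_1a.
Qed.

End Gauge.

(** * Independence of the interior point *)

Lemma polytope_bounded {R : realType} {n : nat} (B : set 'cV[R]_n) :
  polytope B -> exists M, forall x i, B x -> `|x i 0| <= M.
Proof.
move=> [S /finite_seqP[s ->] ->].
have [M sM] : exists M, forall x i, x \in s -> `|x i 0| <= M.
  elim: s => [|y s [M sM]]; first by exists 0.
  exists (\sum_i `|y i 0| + `|M|) => x i; rewrite inE => /orP[/eqP ->|/sM xM].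
    by rewrite (bigD1 i) //= -addrA lerDl addr_ge0 // sumr_ge0.
  rewrite (le_trans (xM i)) // (le_trans (ler_norm _)) // lerDr.
  exact: sumr_ge0.
pose box := [set x : 'cV[R]_n | forall i, `|x i 0| <= M].
have box_conv : convex_set box.
  move=> y z a /set_mem yM /set_mem zM; apply/mem_set => k /=.
  have [a0 a1] : 0 <= a%:num /\ 0 <= 1 - a%:num by rewrite subr_ge0; split.
  change (`|(a%:num *: (y : 'cV[R]_n)
      + (1 - a%:num) *: (z : 'cV[R]_n)) k 0| <= M).
  move: (a%:num) a0 a1 => t t0 t1.
  rewrite !mxE (le_trans (ler_normD _ _)) // !normrM.
  rewrite (ger0_norm t0) (ger0_norm t1).
  rewrite (le_trans (lerD (ler_wpM2l t0 (yM k)) (ler_wpM2l t1 (zM k)))) //.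
  by rewrite -mulrDl addrC subrK mul1r.
have s_box : [set` s] `<=` box by move=> y ys k; exact: sM.
by exists M => x i /(smallest_sub box_conv s_box); exact.
Qed.

Lemma unique_lifting_covering {R : realType} {n : nat} (B : set 'cV[R]_n)
    (f : 'cV[R]_n) : lattice_free B -> polytope B -> interior B f ->
  unique_lifting B f <-> covering f (gauge_at B f).
Proof.
(* In dimension 0 the interior point f would be a lattice point. *)
case: n B f => [|n] B f [_ _ Bconv Bfree] /polytope_bounded[M BM] fB.
  have : (interior B `&` @lattice R 0) f by split=> // -[].
  by rewrite Bfree.
have sub := gauge_at_sublinear Bconv fB.
have lat z := gauge_at_lattice Bconv fB Bfree (z := z).
split; last exact: covering_unique.
apply: unique_covering => //; last exact: ord0.
by move=> p; exact: lattice_inf_gauge_gt0 BM.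
Qed.

Theorem theorem3p6 (R : realType) (n : nat) (B : set 'cV[R]_n)
    (f1 f2 : 'cV[R]_n)
    (Bmax : maximal_lattice_free B) (Bpoly : polytope B)
    (f1B : interior B f1) (f2B : interior B f2) :
  unique_lifting B f1 <-> unique_lifting B f2.
Proof.
have [Bfree _] := Bmax; have [_ _ Bconv _] := Bfree.
rewrite (unique_lifting_covering Bfree Bpoly f1B).
rewrite (unique_lifting_covering Bfree Bpoly f2B).
by split; apply: covering_gauge_invariant.
Qed.
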